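(* Let $A$ be a ring. Let $B$ be an $A$-algebra. Let $(I_\rho)_{\rho\in\mathbb{N}}$ and $(J_\rho)_{\rho\in\mathbb{N}}$ be two ideal semifiltrations of $A$. Let $n\in\mathbb{N}$. Let $u\in B$. Let $\lambda\in\mathbb{N}$. (Then $(I_{\lambda\rho})_{\rho\in\mathbb{N}}$ and hence $(I_{\lambda\rho}J_\rho)_{\rho\in\mathbb{N}}$ are ideal semifiltrations of $A$.) Let $A_{[I]}$ denote the $A$-subalgebra $A[(I_\rho)_{\rho\in\mathbb{N}}\ast Y]$ of the polynomial ring $A[Y]$. (a) The sequence $\left(J_\tau A_{[I]}\right)_{\tau\in\mathbb{N}}$ is an ideal semifiltration of $A_{[I]}$. (b) The element $u$ of $B$ is $n$-integral over $\left(A,(I_{\lambda\rho}J_\rho)_{\rho\in\mathbb{N}}\right)$ if and only if the element $uY^\lambda$ of the polynomial ring $B[Y]$ is $n$-integral over $\left(A_{[I]},(J_\tau A_{[I]})_{\tau\in\mathbb{N}}\right)$.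
   Context: All rings are commutative with unity, and ''$A$-algebra'' means commutative unital $A$-algebra (the structure map $A\to B$ need not be injective). $\mathbb{N}=\{0,1,2,\ldots\}$. An ideal semifiltration of a ring $A$ is a sequence $(I_\rho)_{\rho\in\mathbb{N}}$ of ideals of $A$ such that $I_0=A$ and $I_aI_b\subseteq I_{a+b}$ for all $a,b\in\mathbb{N}$. Given an ideal semifiltration $(I_\rho)_{\rho\in\mathbb{N}}$ of a ring $A$ and $n\in\mathbb{N}$, an element $u$ of an $A$-algebra $B$ is called $n$-integral over $(A,(I_\rho)_{\rho\in\mathbb{N}})$ if there exists $(a_0,a_1,\ldots,a_n)\in A^{n+1}$ such that $\sum_{k=0}^{n}a_ku^k=0$, $a_n=1$, and $a_i\in I_{n-i}$ for every $i\in\{0,1,\ldots,n\}$. The Rees algebra $A[(I_\rho)_{\rho\in\mathbb{N}}\ast Y]$ is the subset $\sum_{i\in\mathbb{N}}I_iY^i$ of $A[Y]$, i.e. the set of all polynomials $P\in A[Y]$ whose $i$-th coefficient lies in $I_i$ for every $i\in\mathbb{N}$; it is an $A$-subalgebra of $A[Y]$. The polynomial ring $B[Y]$ is an $A[Y]$-algebra via the ring homomorphism $A[Y]\to B[Y]$ induced by the structure map $A\to B$, and hence an algebra over the Rees algebra by restriction. For an ideal $J$ of $A$ and an $A$-algebra $A'$, $JA'$ denotes the ideal of $A'$ consisting of finite sums of products $ja'$ with $j\in J$, $a'\in A'$. *)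

(* Defs.v *)
From HB Require Import structures.
From mathcomp Require Import all_boot all_order all_algebra.
From mathcomp Require Import boolp classical_sets functions.

Set Implicit Arguments.
Unset Strict Implicit.
Unset Printing Implicit Defensive.

Import GRing.Theory.
Local Open Scope classical_set_scope.
Local Open Scope ring_scope.

(* The zero ring is allowed throughout (comPzRingType), and an A-algebra B is
   given by its structure map, a ring morphism A -> B which need not be
   injective.  MathComp's {poly R} requires 1 != 0 in R, hence the ring
   [pzpoly A] of finitely supported coefficient sequences below; for a nonzero
   ring, [pzpoly_of_poly] identifies it with {poly A}. *)

Section FiniteSupport.
Variable A : comPzRingType.

Definition finitely_supported : {pred nat -> A} :=
  fun c => `[< exists N, forall i, (N <= i)%N -> c i = 0 >].

Lemma finitely_supportedP (c : nat -> A) :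
  reflect (exists N, forall i, (N <= i)%N -> c i = 0)
          (c \in finitely_supported).
Proof. exact: asboolP. Qed.

Fact finitely_supported_zmod_closed : zmod_closed finitely_supported.
Proof.
split; first by apply/finitely_supportedP; exists 0.
move=> c d /finitely_supportedP[M cM] /finitely_supportedP[N dN].
apply/finitely_supportedP; exists (maxn M N) => i.
rewrite geq_max => /andP[leMi leNi].
change (c i - d i = 0); by rewrite cM ?dN ?subr0.
Qed.

HB.instance Definition _ :=
  GRing.isZmodClosed.Build (nat -> A) finitely_supported
    finitely_supported_zmod_closed.

Record pzpoly := PzPoly {
  coefy :> nat -> A;
  _ : coefy \in finitely_supported
}.

HB.instance Definition _ := [isSub for coefy].
HB.instance Definition _ := [Choice of pzpoly by <:].
HB.instance Definition _ := [SubChoice_isSubZmodule of pzpoly by <:].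

Lemma pzpolyP (p q : pzpoly) : (forall i, p i = q i) <-> p = q.
Proof. by split=> [eqpq|-> //]; apply/val_inj/funext. Qed.

Lemma coefy0 i : (0 : pzpoly) i = 0.
Proof. by []. Qed.

Lemma coefyD (p q : pzpoly) i : (p + q) i = p i + q i.
Proof. by []. Qed.

Lemma coefyN (p : pzpoly) i : (- p) i = - p i.
Proof. by []. Qed.

Fact ymonom_subproof (a : A) (m : nat) :
  (fun i => a *+ (i == m)) \in finitely_supported.
Proof.
apply/finitely_supportedP; exists m.+1 => i lt_mi.
by rewrite gtn_eqF.
Qed.

(* ymonom a m is a Y^m *)
Definition ymonom (a : A) (m : nat) : pzpoly := PzPoly (ymonom_subproof a m).

Lemma coefy_monom a m i : ymonom a m i = a *+ (i == m).
Proof. by []. Qed.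

Fact mul_pzpoly_subproof (p q : pzpoly) :
  (fun i : nat => \sum_(j < i.+1) p j * q (i - j)%N) \in finitely_supported.
Proof.
case: p q => [p /= /finitely_supportedP[M pM]] [q /= /finitely_supportedP[N qN]].
apply/finitely_supportedP; exists (M + N)%N => i leMNi.
rewrite big1 // => j _; have [leMj|ltjM] := leqP M j.
  by rewrite pM ?mul0r.
rewrite qN ?mulr0 // leq_subRL -1?ltnS //.
by apply: leq_trans leMNi; rewrite leq_add2r ltnW.
Qed.

Definition mul_pzpoly (p q : pzpoly) : pzpoly :=
  PzPoly (mul_pzpoly_subproof p q).

Let coef_mul (p q : pzpoly) i :
  mul_pzpoly p q i = \sum_(j < i.+1) p j * q (i - j)%N.
Proof. by []. Qed.

Let coef_mul_rev (p q : pzpoly) i :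
  mul_pzpoly p q i = \sum_(j < i.+1) p (i - j)%N * q j.
Proof.
rewrite coef_mul (reindex_inj rev_ord_inj) /=.
by apply: eq_bigr => j _; rewrite (sub_ordK j).
Qed.

Fact mul_pzpolyC : commutative mul_pzpoly.
Proof.
move=> p q; apply/pzpolyP => i; rewrite coef_mul (coef_mul_rev q p).
by apply: eq_bigr => j _; rewrite mulrC.
Qed.

Fact mul_pzpolyA : associative mul_pzpoly.
Proof.
move=> p q r; apply/pzpolyP=> i.
rewrite (coef_mul p) (coef_mul_rev _ r).
pose coef3 j k := p j * (q (i - j - k)%N * r k).
transitivity (\sum_(j < i.+1) \sum_(k < i.+1 | (k <= i - j)%N) coef3 j k).
  apply: eq_bigr => j _; rewrite coef_mul_rev big_distrr /=.
  by rewrite (big_ord_narrow_leq (leq_subr _ _)).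
rewrite (exchange_big_dep predT) //; apply: eq_bigr => k _.
transitivity (\sum_(j < i.+1 | (j <= i - k)%N) coef3 j k).
  apply: eq_bigl => j; rewrite -ltnS -(ltnS j) -!subSn ?leq_ord //.
  by rewrite -subn_gt0 -(subn_gt0 j) -!subnDA addnC.
rewrite (big_ord_narrow_leq (leq_subr _ _)) coef_mul big_distrl /=.
by apply: eq_bigr => j _; rewrite /coef3 -!subnDA addnC mulrA.
Qed.

Fact mul_1pzpoly : left_id (ymonom 1 0) mul_pzpoly.
Proof.
move=> p; apply/pzpolyP => i; rewrite coef_mul big_ord_recl subn0 mul1r.
by rewrite big1 ?addr0 // => j _; rewrite coefy_monom mul0r.
Qed.

Fact mul_pzpolyDl : left_distributive mul_pzpoly +%R.
Proof.
move=> p q r; apply/pzpolyP=> i; rewrite coefyD !coef_mul -big_split.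
by apply: eq_bigr => j _; rewrite coefyD mulrDl.
Qed.

HB.instance Definition _ := GRing.Zmodule_isComPzRing.Build pzpoly
  mul_pzpolyA mul_pzpolyC mul_1pzpoly mul_pzpolyDl.

Lemma coefy1 i : (1 : pzpoly) i = 1 *+ (i == 0%N).
Proof. by []. Qed.

Lemma coefyM (p q : pzpoly) i : (p * q) i = \sum_(j < i.+1) p j * q (i - j)%N.
Proof. by []. Qed.

End FiniteSupport.

Section CompareWithPoly.
Variable A : comNzRingType.

Fact pzpoly_of_poly_subproof (p : {poly A}) :
  (fun i => p`_i) \in @finitely_supported A.
Proof.
by apply/finitely_supportedP; exists (size p) => i; apply: nth_default.
Qed.

Definition pzpoly_of_poly (p : {poly A}) : pzpoly A :=
  PzPoly (pzpoly_of_poly_subproof p).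

Lemma pzpoly_of_poly_zmod : zmod_morphism pzpoly_of_poly.
Proof. by move=> p q; apply/pzpolyP => i; rewrite coefyD coefyN /= coefB. Qed.

Lemma pzpoly_of_poly_monoid : monoid_morphism pzpoly_of_poly.
Proof.
split=> [|p q]; apply/pzpolyP => i; first by rewrite coefy1 /= coef1.
by rewrite coefyM /= coefM.
Qed.

Lemma pzpoly_of_poly_bij : bijective pzpoly_of_poly.
Proof.
have inj : injective pzpoly_of_poly.
  by move=> p q /pzpolyP eqpq; apply/polyP.
have surj (q : pzpoly A) : exists p, pzpoly_of_poly p = q.
  case: q => q qP; have /finitely_supportedP[N qN] := qP.
  exists (\poly_(i < N) q i); apply/pzpolyP => i /=.
  by rewrite coef_poly; case: ltnP => // /qN.
have [g gK] := choice surj.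
by exists g => // p; apply: inj; rewrite gK.
Qed.

End CompareWithPoly.

Section MapPoly.
Variables (A B : comPzRingType) (phi : {rmorphism A -> B}).

Fact map_pzpoly_subproof (p : pzpoly A) :
  (fun i => phi (p i)) \in @finitely_supported B.
Proof.
case: p => [p /= /finitely_supportedP[N pN]].
by apply/finitely_supportedP; exists N => i /pN ->; rewrite rmorph0.
Qed.

Definition map_pzpoly (p : pzpoly A) : pzpoly B :=
  PzPoly (map_pzpoly_subproof p).

Fact map_pzpoly_is_zmod_morphism : zmod_morphism map_pzpoly.
Proof.
by move=> p q; apply/pzpolyP => i; rewrite coefyD coefyN /= rmorphB.
Qed.

HB.instance Definition _ :=
  GRing.isZmodMorphism.Build (pzpoly A) (pzpoly B) map_pzpoly
    map_pzpoly_is_zmod_morphism.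

Fact map_pzpoly_is_monoid_morphism : monoid_morphism map_pzpoly.
Proof.
split=> [|p q]; apply/pzpolyP => i.
  rewrite -[LHS]/(phi ((1 : pzpoly A) i)) !coefy1.
  by rewrite rmorphMn rmorph1.
rewrite -[LHS]/(phi ((p * q) i)) !coefyM rmorph_sum.
by apply: eq_bigr => j _; rewrite rmorphM.
Qed.

HB.instance Definition _ :=
  GRing.isMonoidMorphism.Build (pzpoly A) (pzpoly B) map_pzpoly
    map_pzpoly_is_monoid_morphism.

End MapPoly.

Section Ideals.
Variable A : comPzRingType.

(* The ideals of ring_quotient are proper, which excludes I_0 = A. *)
Definition is_ideal (I : set A) : Prop :=
  [/\ I 0, forall x y, I x -> I y -> I (x + y) & forall a x, I x -> I (a * x)].

Definition ideal_mul (I J : set A) : set A :=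
  [set x | exists s : seq (A * A),
     (forall p, p \in s -> I p.1 /\ J p.2) /\ x = \sum_(p <- s) p.1 * p.2].

Definition ideal_semifiltration (I : nat -> set A) : Prop :=
  [/\ forall r, is_ideal (I r), I 0%N = [set: A] &
      forall a b, ideal_mul (I a) (I b) `<=` I (a + b)%N].

End Ideals.

(* The ideal J A' of an A-algebra A' with structure map phi. *)
Definition ideal_ext (A A' : comPzRingType) (phi : {rmorphism A -> A'})
    (J : set A) : set A' :=
  [set x | exists s : seq (A * A'),
     (forall p, p \in s -> J p.1) /\ x = \sum_(p <- s) phi p.1 * p.2].

Definition n_integral (A B : comPzRingType) (phi : {rmorphism A -> B})
    (I : nat -> set A) (n : nat) (u : B) : Prop :=
  exists a : 'I_n.+1 -> A,
    [/\ \sum_(k < n.+1) phi (a k) * u ^+ k = 0,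
        a ord_max = 1 &
        forall i : 'I_n.+1, I (n - i)%N (a i)].

Section Rees.
Variables (A : comPzRingType) (I : nat -> set A).

Definition in_rees : {pred pzpoly A} := fun p => `[< forall i, I i (p i) >].

Lemma in_reesP (p : pzpoly A) : reflect (forall i, I i (p i)) (p \in in_rees).
Proof. exact: asboolP. Qed.

Hypothesis semifiltrationI : ideal_semifiltration I.

(* The proof argument only serves to make the predicate, and hence the type
   [rees] below, carry its ring structure. *)
Definition rees_pred of ideal_semifiltration I : {pred pzpoly A} := in_rees.

Local Notation S := (rees_pred semifiltrationI).

Fact rees_subring_closed : subring_closed S.
Proof.
have [idI I0 IM] := semifiltrationI.
have I_0 r : I r 0 by have [] := idI r.
have ID r x y : I r x -> I r y -> I r (x + y) by have [_ + _] := idI r; apply.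
have IZ r a x : I r x -> I r (a * x) by have [_ _] := idI r; apply.
split=> [|p q /in_reesP pI /in_reesP qI|p q /in_reesP pI /in_reesP qI];
    apply/in_reesP => i.
- by rewrite coefy1; case: i => [|i]; rewrite ?I0 //; apply: I_0.
- by rewrite coefyD coefyN -mulN1r; apply: ID => //; apply: IZ.
rewrite coefyM; apply: big_ind => [||j _]; [exact: I_0|exact: ID|].
have := IM j (i - j)%N (p j * q (i - j)%N).
rewrite subnKC ?leq_ord //; apply.
exists [:: (p j, q (i - j)%N)]; rewrite big_seq1; split=> // pq.
by rewrite inE => /eqP->.
Qed.

HB.instance Definition _ :=
  GRing.isSubringClosed.Build (pzpoly A) S rees_subring_closed.

Record rees := Rees { rees_val :> pzpoly A; _ : rees_val \in S }.

HB.instance Definition _ := [isSub for rees_val].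
HB.instance Definition _ := [Choice of rees by <:].
HB.instance Definition _ :=
  GRing.SubChoice_isSubComPzRing.Build (pzpoly A) S rees
    (subringClosedP S).

Fact rees_const_subproof (a : A) : ymonom a 0 \in S.
Proof.
have [idI I0 _] := semifiltrationI.
apply/in_reesP => -[|i]; rewrite coefy_monom /=; first by rewrite I0.
by have [] := idI i.+1.
Qed.

Definition rees_const (a : A) : rees := Rees (rees_const_subproof a).

Fact rees_const_is_zmod_morphism : zmod_morphism rees_const.
Proof.
move=> a b; apply/val_inj/pzpolyP => i.
by rewrite raddfB coefyD coefyN !coefy_monom mulrnBl.
Qed.

HB.instance Definition _ :=
  GRing.isZmodMorphism.Build A rees rees_const rees_const_is_zmod_morphism.

Fact rees_const_is_monoid_morphism : monoid_morphism rees_const.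
Proof.
split=> [|a b]; apply/val_inj/pzpolyP => i; first by rewrite rmorph1.
rewrite rmorphM coefyM big_ord_recl big1 => [|j _].
  by rewrite addr0 !coefy_monom subn0 mulrnAr.
by rewrite coefy_monom mul0r.
Qed.

HB.instance Definition _ :=
  GRing.isMonoidMorphism.Build A rees rees_const rees_const_is_monoid_morphism.

(* The structure map of B[Y] as an algebra over the Rees algebra. *)
Definition rees_map (B : comPzRingType) (phi : {rmorphism A -> B}) :
    rees -> pzpoly B :=
  map_pzpoly phi \o \val.

HB.instance Definition _ (B : comPzRingType) (phi : {rmorphism A -> B}) :=
  GRing.RMorphism.copy (rees_map phi)
    (map_pzpoly phi \o (\val : rees -> pzpoly A)).

End Rees.

Arguments rees_map {A I} semifiltrationI {B} phi.

(* Main.v *)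
Require Import Defs.
From mathcomp Require Import all_boot all_order all_algebra.
From mathcomp Require Import boolp classical_sets functions.
From mathcomp Require Import zify.

Set Implicit Arguments.
Unset Strict Implicit.
Unset Printing Implicit Defensive.

Import GRing.Theory.
Local Open Scope ring_scope.

(** The equivalence holds because the two integrality equations are the same
    equation, once plain and once made homogeneous of degree [lambda n] in [Y].

    If [\sum_k a_k u^k = 0] with [a_k] in [I_(lambda (n - k)) J_(n - k)], then
    multiplying by [Y^(lambda n)] and giving [Y^(lambda (n - k))] to the
    coefficient [a_k] and [Y^(lambda k)] to [u^k] yields an equation for
    [u Y^lambda].  Its coefficients lie in the ideal generated by [J_(n - k)]
    in the Rees algebra: a product [i * j] with [i] in [I_m] and [j] in [J]
    becomes [j * (i Y^m)], and [i Y^m] is in the Rees algebra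
    ([rees_monom_ideal_ext]).

    Conversely, given an equation [\sum_k P_k (u Y^lambda)^k = 0], its
    coefficient at [Y^(lambda n)] only involves the coefficient of
    [Y^(lambda (n - k))] in each [P_k].  These coefficients satisfy the required
    membership because the [m]-th coefficient of an element [\sum j * Q] of the
    ideal generated by [J] is [\sum j * Q_m], with [Q_m] in [I_m]
    ([coefy_ideal_ext]).

    That the families involved are semifiltrations is a formal consequence of
    two facts: products and extensions of ideals are ideals, and they are
    contained in any ideal that contains their generators. *)

(** * Products and extensions of ideals *)

Section IdealProducts.
Variable A : comPzRingType.
Implicit Types I J K : set A.

Lemma ideal_sum K (T : eqType) (s : seq T) (F : T -> A) :
  is_ideal K -> (forall t, t \in s -> K (F t)) -> K (\sum_(t <- s) F t).
Proof.
by move=> [K0 KD _] KF; rewrite big_seq; apply: big_ind => // t /KF.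
Qed.

Lemma mem_ideal_mul I J x y : I x -> J y -> ideal_mul I J (x * y).
Proof.
move=> Ix Jy; exists [:: (x, y)]; rewrite big_seq1; split=> // p.
by rewrite inE => /eqP->.
Qed.

Lemma ideal_mul_sub I J K :
  is_ideal K -> (forall x y, I x -> J y -> K (x * y)) ->
  forall z, ideal_mul I J z -> K z.
Proof.
move=> idK KM z [s [sIJ ->]]; apply: ideal_sum => // p /sIJ[Ip Jp].
exact: KM.
Qed.

Lemma is_ideal_mul I J : is_ideal I -> is_ideal (ideal_mul I J).
Proof.
move=> [_ _ IZ]; split=> [|x y [s [sIJ ->]] [t [tIJ ->]]|a x [s [sIJ ->]]].
- by exists [::]; rewrite big_nil.
- exists (s ++ t); rewrite big_cat; split=> // p.
  by rewrite mem_cat => /orP[/sIJ|/tIJ].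
exists [seq (a * p.1, p.2) | p <- s]; split=> [_ /mapP[p /sIJ[Ip Jp] ->]|].
  by split=> //; apply: IZ.
by rewrite big_map mulr_sumr; apply: eq_bigr => p _; rewrite mulrA.
Qed.

(** The colon ideal [(K : y)]; it lets an inclusion between products of
    generated ideals be checked one factor at a time. *)
Lemma is_ideal_colon K y : is_ideal K -> is_ideal (fun x => K (x * y)).
Proof.
move=> [K0 KD KZ]; split=> [|x x' Kx Kx'|a x Kx].
- by rewrite mul0r.
- by rewrite mulrDl; apply: KD.
by rewrite -mulrA; apply: KZ.
Qed.

End IdealProducts.

Section IdealExtension.
Variables (A A' : comPzRingType) (phi : {rmorphism A -> A'}).
Implicit Types (J : set A) (K : set A').

Lemma mem_ideal_ext J x y : J x -> ideal_ext phi J (phi x * y).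
Proof.
move=> Jx; exists [:: (x, y)]; rewrite big_seq1; split=> // p.
by rewrite inE => /eqP->.
Qed.

Lemma is_ideal_ext J : is_ideal (ideal_ext phi J).
Proof.
split=> [|x y [s [sJ ->]] [t [tJ ->]]|a x [s [sJ ->]]].
- by exists [::]; rewrite big_nil.
- exists (s ++ t); rewrite big_cat; split=> // p.
  by rewrite mem_cat => /orP[/sJ|/tJ].
exists [seq (p.1, a * p.2) | p <- s]; split=> [_ /mapP[p /sJ Jp ->] //|].
by rewrite big_map mulr_sumr; apply: eq_bigr => p _; rewrite mulrCA.
Qed.

Lemma ideal_ext_sub J K :
  is_ideal K -> (forall x, J x -> K (phi x)) ->
  forall z, ideal_ext phi J z -> K z.
Proof.
move=> idK KJ z [s [sJ ->]]; apply: ideal_sum => // p /sJ Jp.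
by have [_ _ KZ] := idK; rewrite mulrC; apply/KZ/KJ.
Qed.

End IdealExtension.

(** * Operations on semifiltrations *)

Section Semifiltrations.
Variable A : comPzRingType.
Implicit Types I J : nat -> set A.

Lemma semifiltrationM I a b x y :
  ideal_semifiltration I -> I a x -> I b y -> I (a + b)%N (x * y).
Proof. by case=> _ _ IM Ix Iy; apply: IM; apply: mem_ideal_mul. Qed.

Lemma semifiltration_reindex I l :
  ideal_semifiltration I -> ideal_semifiltration (fun r => I (l * r)%N).
Proof.
case=> idI I0 IM; split=> [r||a b]; [exact: idI|by rewrite muln0|].
by rewrite mulnDr; apply: IM.
Qed.

Lemma semifiltration_mul I J :
  ideal_semifiltration I -> ideal_semifiltration J ->
  ideal_semifiltration (fun r => ideal_mul (I r) (J r)).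
Proof.
move=> hI hJ; have [idI I0 _] := hI; have [_ J0 _] := hJ.
have idIJ r : is_ideal (ideal_mul (I r) (J r)) by apply: is_ideal_mul.
split=> // [|a b].
  apply/seteqP; split=> // x _; rewrite -[x]mulr1.
  by apply: mem_ideal_mul; rewrite ?I0 ?J0.
apply: ideal_mul_sub => // x y IJx IJy; move: x IJx.
apply: ideal_mul_sub; first exact: is_ideal_colon.
move=> i j Ii Jj; rewrite mulrC; move: y IJy.
apply: ideal_mul_sub; first exact: is_ideal_colon.
move=> i' j' Ii' Jj'; rewrite mulrC mulrACA.
by apply: mem_ideal_mul; apply: semifiltrationM.
Qed.

Lemma semifiltration_ext (A' : comPzRingType) (phi : {rmorphism A -> A'}) J :
  ideal_semifiltration J -> ideal_semifiltration (fun r => ideal_ext phi (J r)).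
Proof.
move=> hJ; have [_ J0 _] := hJ.
have idJ r : is_ideal (ideal_ext phi (J r)) by apply: is_ideal_ext.
split=> // [|a b].
  apply/seteqP; split=> // x _; rewrite -[x]mul1r -(rmorph1 phi).
  by apply: mem_ideal_ext; rewrite J0.
apply: ideal_mul_sub => // x y Jx Jy; move: x Jx.
apply: ideal_ext_sub; first exact: is_ideal_colon.
move=> j Jj; rewrite mulrC; move: y Jy.
apply: ideal_ext_sub; first exact: is_ideal_colon.
move=> j' Jj'; rewrite mulrC -rmorphM -[phi _]mulr1.
by apply: mem_ideal_ext; apply: semifiltrationM.
Qed.

End Semifiltrations.

(** * Monomials and coefficients *)

Section Monomials.
Variable B : comPzRingType.
Implicit Types (p : pzpoly B) (b c : B).

Lemma coefyM_monom p b m i : (p * ymonom b m) (i + m)%N = p i * b.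
Proof.
have lt_i : (i < (i + m).+1)%N by rewrite ltnS leq_addr.
rewrite coefyM (bigD1 (Ordinal lt_i)) // big1 => [|j ne_ji].
  by rewrite coefy_monom /= addKn eqxx addr0.
rewrite coefy_monom; case: eqP => [eqm|_]; last by rewrite mulr0.
case/eqP: ne_ji; apply: val_inj => /=; have := leq_ord j; lia.
Qed.

Lemma ymonomM b c m k : ymonom b m * ymonom c k = ymonom (b * c) (m + k).
Proof.
apply/pzpolyP => i; have [le_ki|lt_ik] := leqP k i.
  by rewrite -(subnK le_ki) coefyM_monom !coefy_monom eqn_add2r mulrnAl.
rewrite coefyM big1 => [|j _]; rewrite !coefy_monom.
  by rewrite ltn_eqF ?(leq_trans lt_ik) ?leq_addl.
by rewrite [_ == k]ltn_eqF ?mulr0 // (leq_ltn_trans (leq_subr _ _)).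
Qed.

Lemma ymonomX b m k : ymonom b m ^+ k = ymonom (b ^+ k) (m * k).
Proof.
elim: k => [|k IHk]; first by rewrite muln0.
by rewrite !exprS IHk ymonomM mulnS.
Qed.

Lemma coefy_sum (T : Type) (s : seq T) (F : T -> pzpoly B) i :
  (\sum_(t <- s) F t) i = \sum_(t <- s) F t i.
Proof. exact: (big_morph (fun p : pzpoly B => p i)). Qed.

End Monomials.

Section ReesCoefficients.
Variables (A : comPzRingType) (I : nat -> set A).
Hypothesis hI : ideal_semifiltration I.
Implicit Types (J : set A) (P : rees hI).

Lemma coefy_rees P i : I i (P i).
Proof. by case: P => P /= /in_reesP. Qed.

Lemma coefy_rees_constM a P i : (rees_const hI a * P) i = a * P i.
Proof.
rewrite -[LHS]/((ymonom a 0 * (P : pzpoly A)) i) mulrC -[in LHS](addn0 i).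
by rewrite coefyM_monom mulrC.
Qed.

Lemma coefy_rees_sum (T : Type) (s : seq T) (F : T -> rees hI) i :
  (\sum_(t <- s) F t) i = \sum_(t <- s) F t i.
Proof. exact: (big_morph (fun P : rees hI => P i)). Qed.

Lemma coefy_ideal_ext J P i :
  ideal_ext (rees_const hI) J P -> ideal_mul (I i) J (P i).
Proof.
have [idI _ _] := hI.
case=> s [sJ ->]; rewrite coefy_rees_sum.
apply: ideal_sum; first exact: is_ideal_mul.
move=> p /sJ Jp; rewrite coefy_rees_constM mulrC.
by apply: mem_ideal_mul; first exact: coefy_rees.
Qed.

Fact rees_monom_subproof a m : I m a -> ymonom a m \in rees_pred hI.
Proof.
move=> Ia; apply/in_reesP => i; rewrite coefy_monom; have [idI _ _] := hI.
by case: eqP => [->//|_]; have [] := idI i.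
Qed.

(** A generator [i * j] of the product gives [j * (i Y^m)].  The element of the
    Rees algebra with value [a Y^m] is produced existentially because [a] is
    only known to be a sum of such generators; the [a] for which it exists form
    an ideal. *)
Lemma rees_monom_ideal_ext J m a :
  ideal_mul (I m) J a ->
  exists P : rees hI, (P : pzpoly A) = ymonom a m /\
                      ideal_ext (rees_const hI) J P.
Proof.
have [E0 ED EZ] := is_ideal_ext (rees_const hI) J.
move: a; apply: ideal_mul_sub => [|i j Ii Jj].
  split=> [|a b [P [Pa JP]] [Q [Qb JQ]]|c a [P [Pa JP]]].
  - by exists 0; split=> //; apply/pzpolyP => i; rewrite coefy_monom mul0rn.
  - exists (P + Q); split; last exact: ED.
    apply/pzpolyP => i.
    by rewrite coefy_monom mulrnDl -!coefy_monom -Pa -Qb.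
  exists (rees_const hI c * P); split; last exact: EZ.
  by apply/pzpolyP => i; rewrite coefy_rees_constM Pa !coefy_monom mulrnAr.
exists (rees_const hI j * Rees (rees_monom_subproof Ii)).
split; last exact: mem_ideal_ext.
by apply/pzpolyP => k; rewrite coefy_rees_constM !coefy_monom mulrnAr mulrC.
Qed.

End ReesCoefficients.

(** * Comparison of the integrality equations *)

Section IntegralityEquations.
Variables (A B : comPzRingType) (phi : {rmorphism A -> B}).
Variables (I J : nat -> set A) (hI : ideal_semifiltration I).
Variables (n : nat) (u : B) (l : nat).

Lemma n_integral_ymonom :
  n_integral phi (fun r => ideal_mul (I (l * r)%N) (J r)) n u ->
  n_integral (rees_map hI phi) (fun t => ideal_ext (rees_const hI) (J t)) n
    (ymonom u l).
Proof.
case=> a [eq_a a_n aIJ].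
have [P PP] := choice (fun k => rees_monom_ideal_ext hI (aIJ k)).
exists P; split=> [||k]; last by have [] := PP k.
  transitivity (ymonom (\sum_(k < n.+1) phi (a k) * u ^+ k) (l * n)).
    apply/pzpolyP => i; rewrite coefy_sum coefy_monom -sumrMnl.
    apply: eq_bigr => k _.
    rewrite [X in X * _](_ : _ = ymonom (phi (a k)) (l * (n - k))).
      by rewrite ymonomX ymonomM -mulnDr subnK ?leq_ord.
    apply/pzpolyP => m; rewrite coefy_monom -rmorphMn -coefy_monom.
    by have [<- _] := PP k.
  by rewrite eq_a; apply/pzpolyP => i; rewrite coefy_monom mul0rn.
apply/val_inj/pzpolyP => i; have [/= -> _] := PP ord_max.
by rewrite a_n subnn muln0.
Qed.

Lemma n_integral_of_ymonom :
  n_integral (rees_map hI phi) (fun t => ideal_ext (rees_const hI) (J t)) n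
    (ymonom u l) ->
  n_integral phi (fun r => ideal_mul (I (l * r)%N) (J r)) n u.
Proof.
case=> P [eq_P P_n PJ]; exists (fun k => P k (l * (n - k))%N).
split=> [||k]; last exact: coefy_ideal_ext (PJ k).
  (* [Y^(l n)] is the degree that the homogeneous form of the equation has. *)
  have /pzpolyP/(_ (l * n)%N) := eq_P; rewrite coefy_sum coefy0.
  apply: etrans; apply: eq_bigr => k _; rewrite ymonomX.
  have ->: (l * n = l * (n - k) + l * k)%N by rewrite -mulnDr subnK ?leq_ord.
  by rewrite coefyM_monom.
by rewrite P_n subnn muln0.
Qed.

End IntegralityEquations.

Theorem theorem4p2 (A B : comPzRingType) (phi : {rmorphism A -> B})
    (I J : nat -> set A)
    (hI : ideal_semifiltration I) (hJ : ideal_semifiltration J)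
    (n : nat) (u : B) (lambda : nat) :
  [/\ ideal_semifiltration (fun rho => I (lambda * rho)%N),
      ideal_semifiltration (fun rho => ideal_mul (I (lambda * rho)%N) (J rho)),
      ideal_semifiltration (fun tau => ideal_ext (rees_const hI) (J tau)) &
      n_integral phi (fun rho => ideal_mul (I (lambda * rho)%N) (J rho)) n u
      <->
      n_integral (rees_map hI phi)
        (fun tau => ideal_ext (rees_const hI) (J tau)) n (ymonom u lambda)].
Proof.
have hIl := semifiltration_reindex lambda hI.
split=> //; [exact: semifiltration_mul|exact: semifiltration_ext|].
by split; [apply: n_integral_ymonom|apply: n_integral_of_ymonom].
Qed.
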